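(* Let $d\in\{2,3\}$, let $n\ge d$, and consider one target and $n$ sensors in $\mathbb{R}^d$, all of the same one of the three sensor types (bearing-only, range-only, received-signal-strength), with arbitrary but fixed positive coefficients $\{c_i\}_{i=1}^n$. Then the problem $$\{g_i^*\}_{i=1}^n=\underset{\{g_i\}_{i=1}^n\subset\mathbb{S}^{d-1}}{\arg\min}\ \|F-\bar{\lambda}I_d\|^2$$ is equivalent to the problem $$\{g_i^*\}_{i=1}^n=\underset{\{g_i\}_{i=1}^n\subset\mathbb{S}^{d-1}}{\arg\min}\ \|G\|^2,\qquad G=\sum_{i=1}^n c_i^2 g_ig_i^T ,$$ that is, the two problems have the same minimizers.
   Context: $\|\cdot\|$ is the Euclidean norm of a vector or the Frobenius norm of a matrix; $\mathbb{S}^{d-1}$ is the unit sphere of $\mathbb{R}^d$; $I_d$ is the $d\times d$ identity matrix. The vector $g_i\in\mathbb{S}^{d-1}$ is the direction from the target to sensor $i$: if $r_i\in\mathbb{R}^d\setminus\{0\}$ is the position of sensor $i$ relative to the target, then $g_i=r_i/\|r_i\|$. A placement is $\{g_i\}_{i=1}^n$. The Fisher information matrix $F\in\mathbb{R}^{d\times d}$ depends on the sensor type, where $\sigma_i>0$ is the noise standard deviation of sensor $i$: - bearing-only: $F=\sum_{i=1}^n c_i^2(I_d-g_ig_i^T)$ with $c_i=1/(\sigma_i\|r_i\|)$; - range-only: $F=\sum_{i=1}^n c_i^2 g_ig_i^T$ with $c_i=1/\sigma_i$; - received-signal-strength (RSS): $F=\sum_{i=1}^n c_i^2 g_ig_i^T$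 with $c_i=1/(\sigma_i\|r_i\|)$. The coefficients $c_i>0$ are treated as arbitrary but fixed constants, and only the unit vectors $g_i$ are variables. $\bar\lambda=\frac1d\sum_{j=1}^d\lambda_j$, where $\lambda_1,\dots,\lambda_d$ are the eigenvalues of $F$. *)

(* Defs.v *)
From HB Require Import structures.
From mathcomp Require Import all_boot all_order all_algebra.
From mathcomp Require Import classical_sets reals.
From mathcomp Require Import polyrcf.

Set Implicit Arguments.
Unset Strict Implicit.
Unset Printing Implicit Defensive.

Import Order.TTheory GRing.Theory Num.Theory.

Local Open Scope classical_set_scope.
Local Open Scope ring_scope.

(* On column vectors ('cV[R]_m = 'M[R]_(m, 1)) this is the Euclidean norm. *)
Definition frobenius_norm (R : realType) (m n : nat) (A : 'M[R]_(m, n)) : R :=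
  Num.sqrt (\sum_(i < m) \sum_(j < n) A i j ^+ 2).

(* The real eigenvalues, each repeated according to its algebraic
   multiplicity. For a symmetric matrix of size d these are the d numbers
   lambda_1, ..., lambda_d. *)
Definition eigenvalues (R : realType) (d : nat) (A : 'M[R]_d) : seq R :=
  flatten [seq nseq (mup a (char_poly A)) a | a <- rootsR (char_poly A)].

Definition mean_eigenvalue (R : realType) (d : nat) (A : 'M[R]_d) : R :=
  d%:R^-1 * \sum_(a <- eigenvalues A) a.

Definition unit_sphere (R : realType) (d : nat) : set 'cV[R]_d :=
  [set x | frobenius_norm x = 1].
Arguments unit_sphere : clear implicits.

Definition placements (R : realType) (d n : nat) : set ('I_n -> 'cV[R]_d) :=
  [set g | forall i, unit_sphere R d (g i)].
Arguments placements : clear implicits.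

Inductive sensor_type := BearingOnly | RangeOnly | RSS.

(* With noise deviation sigma_i > 0 and sensor-target distance rho_i > 0, the
   coefficient c_i stands for 1 / sigma_i for range-only sensors and for
   1 / (sigma_i * rho_i) for the other two types; for each type, any positive
   value can occur. *)
Definition fisher_information (R : realType) (d n : nat) (t : sensor_type)
    (c : 'I_n -> R) (g : 'I_n -> 'cV[R]_d) : 'M[R]_d :=
  match t with
  | BearingOnly => \sum_(i < n) c i ^+ 2 *: (1%:M - g i *m (g i)^T)
  | RangeOnly => \sum_(i < n) c i ^+ 2 *: (g i *m (g i)^T)
  | RSS => \sum_(i < n) c i ^+ 2 *: (g i *m (g i)^T)
  end.

Definition argmin (R : realType) (T : Type) (D : set T) (f : T -> R) : set T :=
  [set x | D x /\ forall y, D y -> f x <= f y].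

(* Main.v *)
(** The matrix [F] is symmetric, so its characteristic polynomial splits over the
    reals and its mean eigenvalue is [\tr F / d]. Write [s] for the sum of the
    [c_i^2]. As the [g_i] are unit vectors, [\tr G = s]. For range-only and RSS
    sensors [F = G]; for bearing-only sensors [F = s I - G], and centring gives
    minus the centred [G]. Hence for every placement the first objective is
    [||G||^2 - s^2 / d], which differs from the second by a constant. *)

Require Import Defs.
From mathcomp Require Import all_boot all_order all_algebra.
From mathcomp Require Import classical_sets reals.
From mathcomp Require Import polyrcf complex.

Import Order.TTheory GRing.Theory Num.Theory.
Local Open Scope ring_scope.

(** The scalar matrix ['X%:M] commutes with [P] over the polynomial ring, so the characteristic
    matrix is itself conjugated and the two outer determinants cancel. *)
Lemma char_poly_conjugate (R : comUnitRingType) (m : nat) (P D : 'M[R]_m) :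
  P \in unitmx -> char_poly (invmx P *m D *m P) = char_poly D.
Proof.
move=> Pu; rewrite /char_poly /char_poly_mx.
have PP : map_mx polyC (invmx P) *m map_mx polyC P = 1%:M.
  by rewrite -map_mxM mulVmx // map_mx1.
have -> : 'X%:M - map_mx polyC (invmx P *m D *m P) =
    map_mx polyC (invmx P) *m ('X%:M - map_mx polyC D) *m map_mx polyC P.
  by rewrite mulmxBr mulmxBl !map_mxM mul_mx_scalar -scalemxAl PP scalemx1.
by rewrite !det_mulmx mulrAC -det_mulmx PP det1 mul1r.
Qed.

(* The roots come from the complex spectral theorem: a real symmetric matrix is
   hermitian, so its complex diagonal form has real entries. *)
Lemma symmetric_char_poly_split (R : rcfType) (m : nat) (A : 'M[R]_m) :
  A^T = A -> exists s : seq R, char_poly A = \prod_(a <- s) ('X - a%:P).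
Proof.
move=> Asym; pose C := [the numClosedFieldType of R[i]].
pose f : {rmorphism R -> C} := real_complex R.
pose B : 'M[C]_m := map_mx f A.
have freal x : f x \is Num.real by apply/complex_realP; exists x.
have Bherm : B \is hermsymmx.
  apply: realsym_hermsym; last by apply/mxOverP => i j; rewrite mxE freal.
  by apply/is_hermitianmxP; rewrite expr0 scale1r map_mx_id // /B map_trmx Asym.
pose e := spectral_diag B.
have /hermitian_normalmx /orthomx_spectralP BE := Bherm.
have ereal i : e 0 i = f (complex.Re (e 0 i)).
  have /mxOverP/(_ 0 i) := hermitian_spectral_diag_real Bherm.
  by move=> ?; apply/esym/RRe_real.
exists [seq complex.Re (e 0 i) | i <- enum 'I_m].
apply: (@map_inj_poly _ _ f); first exact: fmorph_inj.
  exact: rmorph0.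
rewrite map_char_poly -/B BE char_poly_conjugate ?spectral_unit //.
rewrite char_poly_trig ?diag_mx_is_trig // big_map big_enum rmorph_prod /=.
apply: eq_bigr => i _; rewrite mxE eqxx mulr1n rmorphB /= map_polyX map_polyC /=.
by rewrite -/e {1}ereal.
Qed.

(** For a split polynomial the multiplicity of [a] is the number of its occurrences in [s]. *)
Lemma sum_eigenvalues_split (R : realType) (m : nat) (A : 'M[R]_m)
    (s : seq R) :
  char_poly A = \prod_(a <- s) ('X - a%:P) ->
  \sum_(a <- eigenvalues A) a = \sum_(a <- s) a.
Proof.
move=> As; have A0 : char_poly A != 0 by rewrite monic_neq0 ?char_poly_monic.
rewrite /eigenvalues big_flatten big_map /=.
under eq_bigr => a _ do rewrite big_nseq As mu_prod_XsubC iter_addr_0.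
(* Grouped by value, both sums run over the distinct members of [s], up to order. *)
rewrite -[RHS]big_undup_iterop_count /=; apply: perm_big.
apply: uniq_perm; rewrite ?undup_uniq ?uniq_roots // => a.
by rewrite mem_undup -(roots_on_rootsR A0) inE As root_prod_XsubC.
Qed.

(** Vieta: the coefficient of degree [m - 1] of the characteristic polynomial is minus the sum of
    its roots and also minus the trace. *)
Lemma sum_eigenvalues_symmetric (R : realType) (m : nat) (A : 'M[R]_m) :
  (0 < m)%N -> A^T = A -> \sum_(a <- eigenvalues A) a = \tr A.
Proof.
move=> m0 /symmetric_char_poly_split [s As]; rewrite (sum_eigenvalues_split _ _ _ _ As).
have ss : size s = m.
  by have := size_char_poly A; rewrite As size_prod_XsubC => -[].
have := char_poly_trace A m0; rewrite As -{1}ss coefPn_prod_XsubC ?ss -?lt0n //.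
exact: oppr_inj.
Qed.

Lemma frobenius_norm_sqr (R : realType) (m n : nat) (A : 'M[R]_(m, n)) :
  frobenius_norm A ^+ 2 = \tr (A *m A^T).
Proof.
rewrite sqr_sqrtr; last by do 2!apply: sumr_ge0 => ? _; exact: sqr_ge0.
by apply: eq_bigr => i _; rewrite mxE; apply: eq_bigr => j _; rewrite mxE.
Qed.

Lemma frobenius_norm_opp (R : realType) (m n : nat) (A : 'M[R]_(m, n)) :
  frobenius_norm (- A) = frobenius_norm A.
Proof.
congr Num.sqrt; apply: eq_bigr => i _; apply: eq_bigr => j _.
by rewrite mxE sqrrN.
Qed.

(* Centring at the mean of the diagonal is the orthogonal projection onto the
   traceless matrices, hence Pythagoras. *)
Lemma frobenius_norm_centred (R : realType) (m : nat) (A : 'M[R]_m) :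
  (0 < m)%N ->
  frobenius_norm (A - (m%:R^-1 * \tr A)%:M) ^+ 2 =
    frobenius_norm A ^+ 2 - m%:R^-1 * \tr A ^+ 2.
Proof.
move=> m0; have mR : m%:R != 0 :> R by rewrite pnatr_eq0 -lt0n.
rewrite !frobenius_norm_sqr linearB /= tr_scalar_mx mulmxBl !mulmxBr.
rewrite !mul_mx_scalar mul_scalar_mx.
rewrite !raddfB /= !mxtraceZ mxtrace_tr mxtrace_scalar.
by rewrite -[(_ * _) *+ m]mulr_natl mulVKf // subrr addr0 -mulrA -expr2.
Qed.

Lemma mean_eigenvalue_symmetric (R : realType) (m : nat) (A : 'M[R]_m) :
  (0 < m)%N -> A^T = A -> mean_eigenvalue A = m%:R^-1 * \tr A.
Proof. by move=> m0 At; rewrite /mean_eigenvalue sum_eigenvalues_symmetric. Qed.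

Section Fisher.
Variables (R : realType) (d n : nat) (c : 'I_n -> R) (g : 'I_n -> 'cV[R]_d).
Hypotheses (d_gt0 : (0 < d)%N) (g_unit : placements R d n g).

Let G : 'M[R]_d := \sum_(i < n) c i ^+ 2 *: (g i *m (g i)^T).
Let s : R := \sum_(i < n) c i ^+ 2.

Lemma trmx_weighted_gram : G^T = G.
Proof.
rewrite linear_sum; apply: eq_bigr => i _ /=.
by rewrite linearZ /= trmx_mul trmxK.
Qed.

Lemma mxtrace_weighted_gram : \tr G = s.
Proof.
rewrite linear_sum; apply: eq_bigr => i _ /=.
by rewrite mxtraceZ -frobenius_norm_sqr (g_unit i) expr1n mulr1.
Qed.

Lemma fisher_bearing_only : fisher_information BearingOnly c g = s%:M - G.
Proof.
rewrite /= /s raddf_sum -sumrB; apply: eq_bigr => i _.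
by rewrite scalerBr scalemx1.
Qed.

Lemma centred_fisher_norm (t : sensor_type) :
  frobenius_norm (fisher_information t c g -
    (mean_eigenvalue (fisher_information t c g))%:M) ^+ 2 =
  frobenius_norm G ^+ 2 - d%:R^-1 * s ^+ 2.
Proof.
have dR : d%:R != 0 :> R by rewrite pnatr_eq0 -lt0n.
(* Reading [s] as the trace of [G] turns the right side into the squared norm of the centred [G];
   each sensor type then only compares centred matrices up to sign. *)
rewrite -mxtrace_weighted_gram -frobenius_norm_centred //.
case: t.
- rewrite fisher_bearing_only mean_eigenvalue_symmetric //; last first.
    by rewrite linearB /= tr_scalar_mx trmx_weighted_gram.
  (* The mean is [s - d^-1 * s], so its first term cancels the scalar part of [F]. *)
  rewrite raddfB /= mxtrace_scalar mxtrace_weighted_gram mulrBr.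
  rewrite -[s *+ d]mulr_natl mulKf // [(s - _)%:M]raddfB /=.
  by rewrite -frobenius_norm_opp !opprB addrC addrA subrK.
- by rewrite mean_eigenvalue_symmetric // trmx_weighted_gram.
- by rewrite mean_eigenvalue_symmetric // trmx_weighted_gram.
Qed.

End Fisher.

(** Equality is asked on [D] alone because the two objectives are compared only at placements, where
    the trace of [G] is fixed. *)
Lemma argmin_shift (R : realType) (T : Type) (D : set T) (f h : T -> R)
    (k : R) :
  (forall x, D x -> f x = h x - k) -> argmin D f = argmin D h.
Proof.
move=> fh; apply/seteqP; split=> x [Dx xmin]; split=> // y Dy.
- by have := xmin _ Dy; rewrite !fh // lerD2r.
- by rewrite !fh // lerD2r xmin.
Qed.

Theorem mainTheorem1 (R : realType) (d n : nat) (hd : d = 2%N \/ d = 3%N)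
    (hn : (d <= n)%N) (t : sensor_type) (c : 'I_n -> R)
    (hc : forall i, 0 < c i) :
  argmin (placements R d n)
    (fun g => let F := fisher_information t c g in
              frobenius_norm (F - (mean_eigenvalue F)%:M) ^+ 2)
  = argmin (placements R d n)
    (fun g => let G := \sum_(i < n) c i ^+ 2 *: (g i *m (g i)^T) in
              frobenius_norm G ^+ 2).
Proof.
have d_gt0 : (0 < d)%N by case: hd => ->.
by apply: argmin_shift => g g_unit; exact: centred_fisher_norm.
Qed.
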